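(* Let $M$ be the incidence matrix of a simple hypergraph $\mathcal H$ on the vertex set $\{1,\dots,n\}$, and let $h$ be the maximal size of a minimal cover of $\mathcal H$. Then for all $\mathbf a\in\mathbb N^n$, $$\tau_{\mathbf a}(M)\le h\,\nu_{\mathbf a}(M).$$
   Context: $\mathbb N$ includes $0$. A hypergraph consists of a finite vertex set and a collection of nonempty subsets of it, called edges; it is simple if no edge is properly contained in another. A cover of $\mathcal H$ is a set of vertices meeting every edge; a minimal cover is one minimal under inclusion. If $\mathcal H$ has $m$ edges, its incidence matrix is the $n\times m$ matrix whose columns are the $0$-$1$ incidence vectors of the edges. With $\mathbf 1^m=(1,\dots,1)\in\mathbb N^m$ and coordinatewise inequalities, $$\nu_{\mathbf a}(M)=\max\{\mathbf 1^m\cdot\mathbf y\mid\mathbf y\in\mathbb N^m,\ M\mathbf y\le\mathbf a\},\qquad \tau_{\mathbf a}(M)=\min\{\mathbf a\cdot\mathbf z\mid\mathbf z\in\mathbb N^n,\ M^T\mathbf z\ge\mathbf 1^m\}.$$ *)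

(* Defs.v *)
From HB Require Import structures.
From mathcomp Require Import all_boot all_order all_algebra.
From mathcomp.classical Require classical_sets.

Set Implicit Arguments.
Unset Strict Implicit.
Unset Printing Implicit Defensive.

Import GRing.Theory.
Local Open Scope nat_scope.

Record hypergraph (T : finType) := Hypergraph {
  edges : {set {set T}};
  edges_neq0 : set0 \notin edges
}.

Definition simple (T : finType) (H : hypergraph T) : Prop :=
  forall e f, e \in edges H -> f \in edges H -> ~~ (e \proper f).

Definition is_cover (T : finType) (H : hypergraph T) (C : {set T}) : bool :=
  [forall e in edges H, C :&: e != set0].

Definition minimal_cover (T : finType) (H : hypergraph T) (C : {set T}) : bool :=
  minset (is_cover H) C.

Definition max_minimal_cover_size (T : finType) (H : hypergraph T) : nat :=
  \max_(C : {set T} | minimal_cover H C) #|C|.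

(* The columns are ordered by the canonical enumeration of the edge set. *)
Definition incidence_matrix (n : nat) (H : hypergraph 'I_n) :
    'M[nat]_(n, #|edges H|) :=
  \matrix_(i < n, j < #|edges H|) nat_of_bool (i \in (enum_val j : {set 'I_n})).

Definition dot (k : nat) (u v : 'cV[nat]_k) : nat :=
  \sum_(i < k) u i ord0 * v i ord0.

Definition levec (k : nat) (u v : 'cV[nat]_k) : Prop :=
  forall i, u i ord0 <= v i ord0.

Definition ones (m : nat) : 'cV[nat]_m := const_mx 1.

Definition is_maximum (S : nat -> Prop) (k : nat) : Prop :=
  S k /\ forall j, S j -> j <= k.

Definition is_minimum (S : nat -> Prop) (k : nat) : Prop :=
  S k /\ forall j, S j -> k <= j.

(* max S and min S, with junk value 0 when they do not exist; nuP and tauP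
   below show that this never happens for matrices without a zero column. *)
Definition max_of (S : nat -> Prop) : nat :=
  classical_sets.xget 0 (is_maximum S).

Definition min_of (S : nat -> Prop) : nat :=
  classical_sets.xget 0 (is_minimum S).

Definition nu_values (n m : nat) (a : 'cV[nat]_n) (M : 'M[nat]_(n, m))
    (k : nat) : Prop :=
  exists2 y : 'cV[nat]_m, levec (M *m y)%R a & k = dot (ones m) y.

Definition tau_values (n m : nat) (a : 'cV[nat]_n) (M : 'M[nat]_(n, m))
    (k : nat) : Prop :=
  exists2 z : 'cV[nat]_n, levec (ones m) (M^T *m z)%R & k = dot a z.

Definition nu (n m : nat) (a : 'cV[nat]_n) (M : 'M[nat]_(n, m)) : nat :=
  max_of (nu_values a M).

Definition tau (n m : nat) (a : 'cV[nat]_n) (M : 'M[nat]_(n, m)) : nat :=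
  min_of (tau_values a M).

Lemma max_of_ex (S : nat -> Prop) (b : nat) :
  (exists k, S k) -> (forall k, S k -> k <= b) -> is_maximum S (max_of S).
Proof.
move=> [k0 Sk0] Sb.
suff [k kmax] : exists k, is_maximum S k by exact: classical_sets.xgetI kmax.
have exP : exists k, boolp.asbool (S k) by exists k0; apply/boolp.asboolP.
have ubP k : boolp.asbool (S k) -> k <= b by move/boolp.asboolP/Sb.
case: (ex_maxnP exP ubP) => k /boolp.asboolP Sk kmax.
by exists k; split=> // j Sj; apply: kmax; apply/boolp.asboolP.
Qed.

Lemma min_of_ex (S : nat -> Prop) :
  (exists k, S k) -> is_minimum S (min_of S).
Proof.
move=> [k0 Sk0].
suff [k kmin] : exists k, is_minimum S k by exact: classical_sets.xgetI kmin.
have exP : exists k, boolp.asbool (S k) by exists k0; apply/boolp.asboolP.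
case: (ex_minnP exP) => k /boolp.asboolP Sk kmin.
by exists k; split=> // j Sj; apply: kmin; apply/boolp.asboolP.
Qed.

Lemma nuP (n m : nat) (a : 'cV[nat]_n) (M : 'M[nat]_(n, m)) :
  (forall j, exists i, 0 < M i j) -> is_maximum (nu_values a M) (nu a M).
Proof.
move=> Mpos; apply: (@max_of_ex _ (\sum_(j < m) \sum_(i < n) a i ord0)).
  exists 0; exists 0%R; first by move=> i; rewrite mulmx0 mxE.
  by rewrite /dot big1 // => i _; rewrite !mxE muln0.
move=> _ [y Mya ->]; apply: leq_sum => j _; rewrite mxE mul1n.
have [i Mij] := Mpos j.
apply: (@leq_trans (a i ord0)); last by rewrite (bigD1 i) //= leq_addr.
apply: leq_trans (Mya i); rewrite mxE (bigD1 j) //=.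
apply: (@leq_trans (M i j * y j ord0)); first exact: leq_pmull.
exact: leq_addr.
Qed.

Lemma tauP (n m : nat) (a : 'cV[nat]_n) (M : 'M[nat]_(n, m)) :
  (forall j, exists i, 0 < M i j) -> is_minimum (tau_values a M) (tau a M).
Proof.
move=> Mpos; apply: min_of_ex; exists (dot a (ones n)); exists (ones n) => // j.
have [i Mij] := Mpos j.
rewrite !mxE (bigD1 i) //= !mxE.
apply: (@leq_trans (M i j * 1)); first by rewrite muln1.
exact: leq_addr.
Qed.

Lemma incidence_matrix_col (n : nat) (H : hypergraph 'I_n) j :
  exists i, 0 < incidence_matrix H i j.
Proof.
have /set0Pn[i ij] : enum_val j != set0.
  by apply: contraNneq (edges_neq0 H) => <-; apply: enum_valP.
by exists i; rewrite mxE ij.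
Qed.

Lemma minimal_cover_ex (T : finType) (H : hypergraph T) :
  exists C, minimal_cover H C.
Proof.
have covT : is_cover H setT.
  apply/forall_inP => e eH; rewrite setTI.
  by apply: contraNneq (edges_neq0 H) => <-.
by have [C minC _] := minset_exists covT; exists C.
Qed.

(* Main.v *)
Require Import Defs.
From HB Require Import structures.
From mathcomp Require Import all_boot all_order all_algebra.

(** Greedy packing: if every vertex of an edge [e] has positive weight, put [e]
    in the packing and lower the weight of its vertices by 1. This lowers the
    weight of a minimal cover [C] by [#|C :&: e|], hence by at most [h]. When no
    such edge is left, the vertices of weight 0 form a cover, which contains a
    minimal cover of weight 0. *)

Lemma zero_weight_minimal_cover (T : finType) (H : hypergraph T) (w : T -> nat) :
    (forall e, e \in edges H -> exists2 i, i \in e & w i = 0) ->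
  exists2 C, minimal_cover H C & \sum_(i in C) w i = 0.
Proof.
move=> zero_in_edge; pose Z := [set i | w i == 0].
have covZ : is_cover H Z.
  apply/forall_inP => e /zero_in_edge[i ie wi0].
  by apply/set0Pn; exists i; rewrite !inE wi0 eqxx.
have [C minC /subsetP sCZ] := minset_exists covZ; exists C => //.
by apply: big1 => i /sCZ; rewrite inE => /eqP.
Qed.

(** The weight of [C] will bound [tau] from above, the size of [y] will bound [nu] from below. [C]
    is only found once the greedy process stops, but the charge per step is uniform over all minimal
    covers. *)
Lemma packing_minimal_cover (n : nat) (H : hypergraph 'I_n) (a : 'cV[nat]_n) :
  exists C (y : 'cV[nat]_#|edges H|),
    [/\ minimal_cover H C, levec (incidence_matrix H *m y)%R a
      & \sum_(i in C) a i ord0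
          <= max_minimal_cover_size H * dot (ones #|edges H|) y].
Proof.
(* Induction on the total weight, which drops at each greedy step because edges are nonempty. *)
have [s] := ubnP (\sum_i a i ord0).
elim: s a => // s IHs a; rewrite ltnS => sum_a.
have [/exists_inP[e eH /forall_inP a_gt0] | no_edge] :=
    boolP [exists e in edges H, [forall i in e, 0 < a i ord0]]; last first.
  have [e eH | C minC aC0] :=
      @zero_weight_minimal_cover _ H (fun i => a i ord0).
    move: no_edge; rewrite negb_exists_in => /forall_inP/(_ e eH).
    rewrite negb_forall_in => /exists_inP[i ie].
    by rewrite -eqn0Ngt => /eqP ai0; exists i.
  exists C, 0%R; split=> //; last by rewrite aC0.
  by move=> i; rewrite mulmx0 mxE.
pose a' : 'cV[nat]_n := (\col_i (a i ord0 - (i \in e))%N)%R.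
(* The truncated subtraction in [a'] is exact, since [a] is positive on [e]. *)
have aE i : a i ord0 = a' i ord0 + (i \in e).
  by rewrite mxE subnK //; case: (boolP (i \in e)) => // /a_gt0.
have [|C [y [minC y_le C_le]]] := IHs a'.
  apply: leq_trans sum_a; rewrite (eq_bigr _ (fun i _ => aE i)) big_split /=.
  have /set0Pn[i ie] : e != set0.
    by apply: contraNneq (edges_neq0 H) => <-.
  by rewrite -addn1 leq_add2l (bigD1 i) //= ie.
(* [j] is the column of [e]: adding [delta_mx j ord0] to [y] packs [e] once more. *)
pose j := enum_rank_in eH e.
exists C, (y + delta_mx j ord0)%R; split=> //.
  move=> i; rewrite mulmxDr mxE aE; apply: leq_add; first exact: y_le.
  by rewrite -colE !mxE enum_rankK_in.
have -> : dot (ones #|edges H|) (y + delta_mx j ord0)%R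
          = dot (ones #|edges H|) y + 1.
  have sum_delta : \sum_k (k == j) = 1.
    by rewrite (bigD1 j) //= eqxx big1 // => k /negbTE->.
  rewrite /dot -[X in _ + X]sum_delta -big_split; apply: eq_bigr => k _ /=.
  by rewrite !mxE !mul1n eqxx andbT; case: (k == j).
(* Passing from [a'] back to [a] adds [#|C :&: e|], at most [#|C|], to the weight of [C]. *)
rewrite mulnDr muln1 (eq_bigr _ (fun i _ => aE i)) big_split leq_add //=.
apply: (@leq_trans #|C|); last exact: leq_bigmax_cond.
by rewrite -sum1_card; apply: leq_sum => i _; apply: leq_b1.
Qed.

Theorem theorem4p2 (n : nat) (H : hypergraph 'I_n) (hH : simple H)
    (a : 'cV[nat]_n) :
  tau a (incidence_matrix H)
    <= max_minimal_cover_size H * nu a (incidence_matrix H).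
Proof.
have [_ nu_max] := nuP a (@incidence_matrix_col _ H).
have [_ tau_min] := tauP a (@incidence_matrix_col _ H).
have [C [y [minC y_le C_le]]] := packing_minimal_cover n H a.
apply: (@leq_trans (\sum_(i in C) a i ord0)); last first.
  apply: leq_trans C_le _; rewrite leq_mul2l nu_max ?orbT //.
  by exists y.
(* The indicator vector of [C] is feasible for [tau] because [C] meets every edge. *)
apply: tau_min; exists (\col_i (i \in C : nat))%R; last first.
  rewrite /dot big_mkcond; apply: eq_bigr => i _.
  by rewrite mxE; case: (i \in C); rewrite ?muln1 ?muln0.
move=> j; have /minsetp/forall_inP/(_ _ (enum_valP j))/set0Pn[i] := minC.
rewrite inE => /andP[iC ij].
by rewrite !mxE (bigD1 i) //= !mxE ij iC.
Qed.
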